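(* Fix $p\in(0,1)$ and, for each $n\ge 1$, let $\mu$ be the $p$-biased measure on $\{-1,1\}^n$ and let $f_n:\{-1,1\}^n\to\mathbb{R}$. Put $f_n^{(i)} = f_n - E_i[f_n]$ for $1\le i\le n$. Let $\rho$ be any one of the three functions (i), (ii), (iii) listed in the context, and set $\rho_2(\alpha)=\rho(e^{\alpha}+1)$ for $\alpha>0$. Suppose that $\mathrm{var}(f_n)>0$ for all $n$ and that $\mathrm{var}(f_n)=o(n^{\varepsilon})$ as $n\to\infty$ for every $\varepsilon>0$. Then $$\liminf_{n\to\infty}\frac{\max_{1\le i\le n}\lVert f_n^{(i)}\rVert_1}{\mathrm{var}(f_n)\,\frac{\ln n}{n}}\;\ge\;\frac{C_0}{M_0},$$ where $$M_0=\limsup_{n\to\infty}\ \max_{i:\,f_n^{(i)}\ne 0}\frac{\lVert f_n^{(i)}\rVert_2^2}{\lVert f_n^{(i)}\rVert_1},\qquad C_0=\sup_{\alpha>0}\frac{\tanh(\alpha/2)}{\alpha-\ln\left(\rho_2(\alpha)^2\right)}.$$ If $M_0=0$, the quantity $C_0/M_0$ is interpreted as $+\infty$; if $M_0=\infty$, it is interpreted as $0$.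
   Context: The $p$-biased measure on $\{-1,1\}^n$ is the product probability measure under which each coordinate independently equals $1$ with probability $p$ and $-1$ with probability $1-p$. All norms and variances are with respect to $\mu$: $\lVert f\rVert_q^q=\int|f|^q\,d\mu$, and $\mathrm{var}(f)=E[f^2]-E[f]^2$. $E_i[f]$ denotes integration of $f$ over the $i$-th coordinate only (the other coordinates being held fixed), so $E_i[f]$ is a function of the remaining coordinates. Let $\lambda=\min\{p,1-p\}$. The three admissible functions $\rho$, defined for $q\ge 2$, are: (i) $\rho(q)=\lambda^{\frac12-\frac1q}$; (ii) $\rho(q)=\sqrt{q-1}\,\sqrt{\dfrac{\sinh\left(-\frac1q\ln\frac{\lambda}{1-\lambda}\right)}{\sinh\left(-\left(1-\frac1q\right)\ln\frac{\lambda}{1-\lambda}\right)}}$, understood as its limiting value $1$ when $\lambda=\frac12$; (iii) $\rho(q)=\sqrt{\dfrac{\lambda}{1-\lambda}}$ (constant in $q$). *)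

(* Defs.v *)
From HB Require Import structures.
From mathcomp Require Import all_boot all_order all_algebra.
From mathcomp Require Import all_classical all_reals all_analysis.
Set Implicit Arguments.
Unset Strict Implicit.
Unset Printing Implicit Defensive.
Import Order.TTheory GRing.Theory Num.Theory.
Import numFieldNormedType.Exports.
Local Open Scope classical_set_scope.
Local Open Scope ring_scope.

(* Points of {-1,1}^n: [true] stands for the value 1, [false] for -1. *)
Notation cube n := {ffun 'I_n -> bool}.

Section BiasedCube.
Context {R : realType}.
Implicit Types (p q : R) (n : nat).

Definition bias p (b : bool) : R := if b then p else 1 - p.

(* The mass of the singleton {x} under the p-biased measure. Every function
   on the finite cube is integrated by a finite sum against these masses. *)
Definition biased_mass p n (x : cube n) : R := \prod_(i < n) bias p (x i).

Definition Ex p n (f : cube n -> R) : R := \sum_(x : cube n) biased_mass p x * f x.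

Definition Var p n (f : cube n -> R) : R := Ex p (fun x => f x ^+ 2) - Ex p f ^+ 2.

Definition Lqnorm p q n (f : cube n -> R) : R :=
  (Ex p (fun x => `|f x| `^ q)) `^ q^-1.

Definition set_coord n (x : cube n) (i : 'I_n) (b : bool) : cube n :=
  [ffun j => if j == i then b else x j].

(* E_i[f] does not depend on coordinate i; it is kept as a function on the
   whole cube so that it can be subtracted from f. *)
Definition Ex_coord p n (i : 'I_n) (f : cube n -> R) : cube n -> R :=
  fun x => \sum_(b : bool) bias p b * f (set_coord x i b).

Definition centered p n (i : 'I_n) (f : cube n -> R) : cube n -> R :=
  f \- Ex_coord p i f.

Definition sinh (x : R) : R := (expR x - expR (- x)) / 2.
Definition cosh (x : R) : R := (expR x + expR (- x)) / 2.
Definition tanh (x : R) : R := sinh x / cosh x.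

Definition lam p : R := Num.min p (1 - p).

Definition rho_i p q : R := lam p `^ (2^-1 - q^-1).

(* At lam p = 1/2 the quotient of sinh's is 0/0; 1 is the limit of the whole
   expression as lam p tends to 1/2. *)
Definition rho_ii p q : R :=
  if lam p == 2^-1 then 1 else
  let l := ln (lam p / (1 - lam p)) in
  Num.sqrt (q - 1) *
  Num.sqrt (sinh (- (q^-1 * l)) / sinh (- ((1 - q^-1) * l))).

Definition rho_iii p q : R := Num.sqrt (lam p / (1 - lam p)).

Definition admissible p (rho : R -> R) : Prop :=
  [\/ forall q, 2 <= q -> rho q = rho_i p q,
      forall q, 2 <= q -> rho q = rho_ii p q |
      forall q, 2 <= q -> rho q = rho_iii p q].

Definition rho2 (rho : R -> R) (alpha : R) : R := rho (expR alpha + 1).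

Definition C0 (rho : R -> R) : \bar R :=
  ereal_sup [set (tanh (alpha / 2) / (alpha - ln (rho2 rho alpha ^+ 2)))%:E
            | alpha in [set alpha : R | 0 < alpha]].

(* In the two maxima below the terms are nonnegative, so the default value 0
   is harmless (the second index set is nonempty as soon as the variance of f
   is nonzero); the inequality [!= 0] is between functions on the cube. *)
Definition max_L1 p n (f : cube n -> R) : R :=
  \big[Num.max/0]_(i < n) Lqnorm p 1 (centered p i f).

Definition max_ratio p n (f : cube n -> R) : R :=
  \big[Num.max/0]_(i < n | centered p i f != (fun=> 0))
    (Lqnorm p 2 (centered p i f) ^+ 2 / Lqnorm p 1 (centered p i f)).

Definition M0 p (f : forall n, cube n -> R) : \bar R :=
  limn_esup (fun n => (max_ratio p (f n))%:E).

End BiasedCube.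

(* Main.v *)
Require Import Defs.
From HB Require Import structures.
From mathcomp Require Import all_boot all_order all_algebra.
From mathcomp Require Import all_classical all_reals all_analysis.
From mathcomp Require Import ring lra.
Set Implicit Arguments.
Unset Strict Implicit.
Unset Printing Implicit Defensive.
Import Order.TTheory GRing.Theory Num.Theory.
Import numFieldNormedType.Exports.
Local Open Scope classical_set_scope.
Local Open Scope ring_scope.

(* Whichever rho is chosen, C0 is at most 1/C, where C = (ln q - ln p)/(q - p),
   q = 1 - p, is the optimal logarithmic Sobolev constant of the p-biased bit
   (for rho of kind (ii), 1/C is the limit of the quotients as alpha -> 0), so
   hypercontractivity can be replaced by the log-Sobolev inequality
   Ent(g^2) <= C sum_j ||g^(j)||_2^2. As in Falik and Samorodnitsky, write f as
   E f plus martingale differences d_i, apply log-Sobolev to each d_i and use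
   Ent(g^2) >= ||g||_2^2 ln (||g||_2^2 / ||g||_1^2), ||d_i||_1 <= ||f^(i)||_1
   and sum_i ||d_i^(j)||_2^2 <= ||f^(j)||_2^2. With V = var f,
   m = max_i ||f^(i)||_1 and M = max_i ||f^(i)||_2^2 / ||f^(i)||_1 this gives
   V ln (V / (n m^2)) <= C n M m. As V = n^o(1), it forces
   m >= (1 - o(1)) V ln n / (C M n). *)

(** * Hyperbolic functions and the two-point logarithmic Sobolev inequality *)

Section Hyperbolic.
Context {R : realType}.
Implicit Types x y z a b c : R.

Lemma ln_leB1 (t : R) : 0 < t -> ln t <= t - 1.
Proof. by move=> t0; rewrite -{1}[t](subrKC 1); apply: le_ln1Dx; lra. Qed.

Lemma le_of_derive_ge0 (f df : R -> R) a b : a <= b ->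
  (forall x, a <= x <= b -> is_derive x 1 f (df x)) ->
  (forall x, a <= x <= b -> 0 <= df x) -> f a <= f b.
Proof.
move=> ab fdf df0.
have fdfo x : x \in `]a, b[%R -> is_derive x 1 f (df x).
  by rewrite in_itv /= => /andP[ax xb]; apply: fdf; rewrite !ltW.
have fc : {within `[a, b], continuous f}.
  apply: derivable_within_continuous => x; rewrite in_itv /= => xab.
  by have [] := fdf x xab.
have [c + fab] := MVT_segment ab fdfo fc; rewrite in_itv /= => cab.
by rewrite -subr_ge0 fab mulr_ge0 ?subr_ge0// df0.
Qed.

Lemma is_derive_expRN x :
  is_derive x 1 (fun t : R => expR (- t)) (- expR (- x)).
Proof.
by rewrite -mulrN1; exact: (@is_derive1_comp R expR -%R).
Qed.

Global Instance is_derive_sinh x : is_derive x 1 (@sinh R) (cosh x).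
Proof.
have dN := is_derive_expRN x.
rewrite (_ : @sinh R = 2^-1 \*: (expR - (fun t => expR (- t)))); last first.
  by apply/funext => t; rewrite /sinh mulrC.
by apply: is_derive_eq; rewrite opprK /cosh mulrC.
Qed.

Global Instance is_derive_cosh x : is_derive x 1 (@cosh R) (sinh x).
Proof.
have dN := is_derive_expRN x.
rewrite (_ : @cosh R = 2^-1 \*: (expR + (fun t => expR (- t)))); last first.
  by apply/funext => t; rewrite /cosh mulrC.
by apply: is_derive_eq; rewrite /sinh mulrC.
Qed.

Lemma cosh_gt0 x : 0 < cosh x.
Proof. by rewrite /cosh divr_gt0// addr_gt0 ?expR_gt0. Qed.

Lemma coshN x : cosh (- x) = cosh x.
Proof. by rewrite /cosh opprK addrC. Qed.

Lemma sinhN x : sinh (- x) = - sinh x.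
Proof. by rewrite /sinh opprK -mulNr opprB. Qed.

Lemma sinh0 : sinh 0 = 0 :> R.
Proof. by rewrite /sinh oppr0 subrr mul0r. Qed.

Lemma cosh2_sinh2 x : cosh x ^+ 2 - sinh x ^+ 2 = 1.
Proof.
by rewrite -[RHS](expRxMexpNx_1 x) /cosh /sinh; field.
Qed.

Lemma sinh_gt0 x : (0 < sinh x) = (0 < x).
Proof.
rewrite /sinh pmulr_lgt0 ?invr_gt0// subr_gt0 ltr_expR.
by apply/idP/idP => h; lra.
Qed.

Lemma sinh_ge0 x : 0 <= x -> 0 <= sinh x.
Proof.
by rewrite le_eqVlt => /predU1P[<-|x0]; rewrite ?sinh0// ltW// sinh_gt0.
Qed.

Lemma cosh_ge1 x : 1 <= cosh x.
Proof.
rewrite -(@ler_pXn2r _ 2) ?nnegrE ?(ltW (cosh_gt0 x))// expr1n.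
rewrite -(cosh2_sinh2 x).
by rewrite lerBlDr lerDl sqr_ge0.
Qed.

Lemma cosh_le x y : 0 <= x <= y -> cosh x <= cosh y.
Proof.
move=> /andP[x0 xy]; apply: (@le_of_derive_ge0 _ sinh) => // t /andP[xt _].
by apply: sinh_ge0; exact: le_trans xt.
Qed.

Lemma le_sinh x : 0 <= x -> x <= sinh x.
Proof.
move=> x0; rewrite -subr_ge0; have {1}<- : @sinh R 0 - 0 = 0.
  by rewrite sinh0 subrr.
apply: (@le_of_derive_ge0 (@sinh R - id) (fun t => cosh t - 1)) => // t _.
by rewrite subr_ge0 cosh_ge1.
Qed.

Lemma sinh_le_xcosh x : 0 <= x -> sinh x <= x * cosh x.
Proof.
move=> x0; rewrite -subr_ge0.
have {1}<- : 0 * cosh 0 - sinh 0 = 0 :> R by rewrite sinh0 mul0r subrr.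
apply: (@le_of_derive_ge0 (id * @cosh R - @sinh R) (fun t => t * sinh t)) => //.
  by move=> t _; apply: is_derive_eq; rewrite /GRing.scale/=; ring.
by move=> t /andP[t0 _]; rewrite mulr_ge0// sinh_ge0.
Qed.

(** As a function of y, the difference of the two sides vanishes at y = x and has derivative x cosh
    y - sinh x >= x cosh x - sinh x >= 0. *)
Lemma sinh_ratio_le x y : 0 <= x <= y -> y * sinh x <= x * sinh y.
Proof.
move=> /andP[x0 xy]; rewrite -subr_ge0.
have {1}<- : x * sinh x - x * sinh x = 0 by rewrite subrr.
apply: (@le_of_derive_ge0 (x \*: @sinh R - id * cst (sinh x))
  (fun t => x * cosh t - sinh x)) => //.
  by move=> t _; apply: is_derive_eq; rewrite /GRing.scale/=; ring.
move=> t /andP[xt _]; rewrite subr_ge0 (le_trans (sinh_le_xcosh x0))//.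
by rewrite ler_wpM2l// cosh_le// x0.
Qed.

(** The continuous extension of x / sinh x to 0, so that p = 1/2 needs no separate two-point
    inequality. *)
Definition xsinhV x : R := if x == 0 then 1 else x / sinh x.

Lemma xsinhVN x : xsinhV (- x) = xsinhV x.
Proof.
by rewrite /xsinhV oppr_eq0; case: ifP => // _; rewrite sinhN invrN mulrNN.
Qed.

Lemma xsinhVE x : xsinhV x * sinh x = x.
Proof.
rewrite /xsinhV; case: eqP => [->|/eqP x0]; first by rewrite sinh0 mulr0.
rewrite divfK//; apply: contra_neq x0 => s0.
have := ltr_pM2l (@ltr01 R); case: (ltrgt0P x) => // h.
  by move: h; rewrite -sinh_gt0 s0 ltxx.
by move: h; rewrite -oppr_gt0 -sinh_gt0 sinhN s0 oppr0 ltxx.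
Qed.

Lemma xsinhV_gt0 x : 0 < xsinhV x.
Proof.
have pos z : 0 < z -> 0 < xsinhV z.
  by move=> z0; rewrite /xsinhV gt_eqF// divr_gt0// sinh_gt0.
case: (ltrgt0P x) => [/pos//|x0|->].
  by rewrite -xsinhVN pos// oppr_gt0.
by rewrite /xsinhV eqxx.
Qed.

Lemma xsinhV_sqrt x : Num.sqrt (xsinhV x ^+ 2 + x ^+ 2) = xsinhV x * cosh x.
Proof.
have -> : xsinhV x ^+ 2 + x ^+ 2 = (xsinhV x * cosh x) ^+ 2.
  rewrite -{2}[x]xsinhVE; have /eqP := cosh2_sinh2 x.
  by rewrite subr_eq => /eqP e; rewrite exprMn [RHS]exprMn e; ring.
by rewrite sqrtr_sqr ger0_norm// mulr_ge0 ?ltW ?xsinhV_gt0 ?cosh_gt0.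
Qed.

Lemma xsinhV_sinh_ge y z : 0 <= y <= z -> z <= xsinhV y * sinh z.
Proof.
move=> /andP[y0 yz]; have [->|yn0] := eqVneq y 0.
  by rewrite /xsinhV eqxx mul1r le_sinh// (le_trans y0).
have {}y0 : 0 < y by rewrite lt_def yn0.
rewrite /xsinhV (negbTE yn0) mulrAC ler_pdivlMr ?sinh_gt0//.
by apply: sinh_ratio_le; rewrite (ltW y0).
Qed.

Lemma xsinhV_sinh_le y z : 0 <= z <= y -> xsinhV y * sinh z <= z.
Proof.
move=> /andP[z0 zy]; have [y0|yn0] := eqVneq y 0.
  have -> : z = 0 by apply/le_anti; rewrite z0 andbT -y0.
  by rewrite sinh0 mulr0.
have {}y0 : 0 < y by rewrite lt_def yn0 (le_trans z0).
rewrite /xsinhV (negbTE yn0) mulrAC ler_pdivrMr ?sinh_gt0//.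
by apply: sinh_ratio_le; rewrite z0.
Qed.

(* d/dz (ln (cosh z) - sqrt (c^2 + z^2)) = tanh z - z / sqrt (c^2 + z^2) has
   the sign of c sinh z - z, which vanishes at z = y for c = y / sinh y. *)
Lemma ln_cosh_ge_pos y z : 0 <= y -> 0 <= z ->
  ln (cosh y) - xsinhV y * cosh y <=
  ln (cosh z) - Num.sqrt (xsinhV y ^+ 2 + z ^+ 2).
Proof.
move=> y0 z0; rewrite -xsinhV_sqrt; set c := xsinhV y.
have c0 : 0 <= c := ltW (xsinhV_gt0 y).
have s0 t : 0 < c ^+ 2 + t ^+ 2.
  by rewrite ltr_wpDr ?sqr_ge0// exprn_gt0// xsinhV_gt0.
pose F := fun t : R => ln (cosh t) - Num.sqrt (c ^+ 2 + t ^+ 2).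
pose dF := fun t : R => sinh t / cosh t - t / Num.sqrt (c ^+ 2 + t ^+ 2).
have dFE (t : R) : is_derive t 1 F (dF t).
  have d1 : is_derive t 1 (@ln R \o @cosh R) ((cosh t)^-1 * sinh t).
    by apply: is_derive1_comp; exact: is_derive1_ln (cosh_gt0 t).
  have d3 : is_derive t 1 (fun u : R => c ^+ 2 + u ^+ 2) (2 * t).
    rewrite (_ : (fun _ => _) = cst (c ^+ 2) + (id : R -> R) ^+ 2); last first.
      by apply/funext => u /=.
    by apply: is_derive_eq; rewrite add0r expr1 /GRing.scale/= mulr1 mulr_natl.
  have d2 : is_derive t 1 ((@Num.sqrt R) \o (fun u : R => c ^+ 2 + u ^+ 2))
      ((2 * Num.sqrt (c ^+ 2 + t ^+ 2))^-1 * (2 * t)).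
    by apply: is_derive1_comp; exact: is_derive1_sqrt (s0 t).
  apply: (is_derive_eq (is_deriveB d1 d2)).
  rewrite /dF mulrC; congr (_ - _).
  have := s0 t; rewrite -sqrtr_gt0 => st; field.
  by rewrite gt_eqF.
(* Comparing squares removes the root: for t >= 0, [dF t] has the sign of c sinh t - t. *)
have sq t : (sinh t * Num.sqrt (c ^+ 2 + t ^+ 2)) ^+ 2 - (t * cosh t) ^+ 2 =
    (c * sinh t) ^+ 2 - t ^+ 2.
  have /eqP := cosh2_sinh2 t; rewrite subr_eq => /eqP e.
  rewrite exprMn sqr_sqrtr; last exact: ltW.
  by rewrite (exprMn 2 t) e; ring.
have dFE2 t : dF t = (sinh t * Num.sqrt (c ^+ 2 + t ^+ 2) - t * cosh t) /
    (cosh t * Num.sqrt (c ^+ 2 + t ^+ 2)).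
  have := s0 t; rewrite -sqrtr_gt0 => st; have ct := cosh_gt0 t.
  by rewrite /dF; field; rewrite !gt_eqF.
have sqr_le (u v : R) : 0 <= u -> 0 <= v -> u ^+ 2 <= v ^+ 2 -> u <= v.
  by move=> u0 v0; rewrite ler_sqr.
have dF_ge0 (t : R) : 0 <= t -> t <= c * sinh t -> 0 <= dF t.
  move=> t0 ts; have sh0 := sinh_ge0 t0.
  rewrite dFE2 divr_ge0 ?mulr_ge0 ?sqrtr_ge0 ?(ltW (cosh_gt0 t))// subr_ge0.
  apply: sqr_le.
  - by apply: mulr_ge0 => //; exact: ltW (cosh_gt0 t).
  - by apply: mulr_ge0 => //; exact: sqrtr_ge0.
  rewrite -subr_ge0 sq subr_ge0.
  by apply: lerXn2r; rewrite ?nnegrE//; exact: mulr_ge0.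
have dF_le0 (t : R) : 0 <= t -> c * sinh t <= t -> dF t <= 0.
  move=> t0 ts; have sh0 := sinh_ge0 t0; rewrite -oppr_ge0.
  rewrite dFE2 -mulNr opprB.
  rewrite divr_ge0 ?mulr_ge0 ?sqrtr_ge0 ?(ltW (cosh_gt0 t))// subr_ge0.
  apply: sqr_le.
  - by apply: mulr_ge0 => //; exact: sqrtr_ge0.
  - by apply: mulr_ge0 => //; exact: ltW (cosh_gt0 t).
  rewrite -subr_le0 sq subr_le0.
  by apply: lerXn2r; rewrite ?nnegrE//; exact: mulr_ge0.
(* F is nonincreasing on [0, y] and nondecreasing beyond, so its minimum over z >= 0 is at y. *)
have [yz|/ltW zy] := leP y z.
  apply: (@le_of_derive_ge0 F dF) => // t /andP[yt _].
  by apply: dF_ge0; rewrite ?(le_trans y0)// xsinhV_sinh_ge// y0.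
rewrite -lerN2; apply: (@le_of_derive_ge0 (- F) (- dF)) => // t /andP[zt ty].
have t0 := le_trans z0 zt.
by rewrite oppr_ge0 dF_le0// xsinhV_sinh_le// t0.
Qed.

Lemma ln_cosh_ge y z :
  ln (cosh y) - xsinhV y * cosh y <=
  ln (cosh z) - Num.sqrt (xsinhV y ^+ 2 + z ^+ 2).
Proof.
wlog y0 : y / 0 <= y.
  move=> h; have [/h//|y0] := leP 0 y.
  by rewrite -xsinhVN -(coshN y); apply: h; rewrite oppr_ge0 ltW.
wlog z0 : z / 0 <= z; last exact: ln_cosh_ge_pos.
move=> h; have [/h//|z0] := leP 0 z.
by rewrite -(coshN z) -(sqrrN z); apply: h; rewrite oppr_ge0 ltW.
Qed.

Lemma cosh_ln a b : 0 < a -> 0 < b ->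
  cosh ((ln a - ln b) / 2) = (a + b) / 2 * expR (- ((ln a + ln b) / 2)).
Proof.
move=> a0 b0; rewrite /cosh mulrAC; congr (_ / _).
rewrite -[in RHS](lnK a0) -[in RHS](lnK b0) !expRK [RHS]mulrDl -!expRD.
by congr (expR _ + expR _); field.
Qed.

Lemma sinh_ln a b : 0 < a -> 0 < b ->
  sinh ((ln a - ln b) / 2) = (a - b) / 2 * expR (- ((ln a + ln b) / 2)).
Proof.
move=> a0 b0; rewrite /sinh mulrAC; congr (_ / _).
rewrite -[in RHS](lnK a0) -[in RHS](lnK b0) !expRK [RHS]mulrBl -!expRD.
by congr (expR _ - expR _); field.
Qed.

Lemma ln_cosh_ln a b : 0 < a -> 0 < b ->
  ln (cosh ((ln a - ln b) / 2)) = ln ((a + b) / 2) - (ln a + ln b) / 2.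
Proof.
move=> a0 b0; rewrite cosh_ln// lnM ?posrE ?expR_gt0 ?expRK//.
by rewrite divr_gt0// addr_gt0.
Qed.

(** Since (r^2 - w^2)^2 + (2rw)^2 = (r^2 + w^2)^2, this is Cauchy-Schwarz for (z, c) and (r^2 - w^2,
    2rw), proved by Lagrange's identity. *)
Lemma rotation_le c z r w :
  z * (r ^+ 2 - w ^+ 2) + 2 * c * (r * w) <=
  Num.sqrt (c ^+ 2 + z ^+ 2) * (r ^+ 2 + w ^+ 2).
Proof.
apply: le_trans (ler_norm _) _; set X := _ + _ * (r * w).
have rw0 : 0 <= r ^+ 2 + w ^+ 2 by rewrite addr_ge0 ?sqr_ge0.
rewrite -[leRHS]ger0_norm ?mulr_ge0 ?sqrtr_ge0// -ler_sqr ?nnegrE//.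
rewrite !real_normK ?num_real// exprMn sqr_sqrtr ?addr_ge0 ?sqr_ge0// -subr_ge0.
suff -> : (c ^+ 2 + z ^+ 2) * (r ^+ 2 + w ^+ 2) ^+ 2 - X ^+ 2 =
  (c * (r ^+ 2 - w ^+ 2) - 2 * z * (r * w)) ^+ 2 by exact: sqr_ge0.
by rewrite /X; ring.
Qed.

(* This is (ln q - ln p) / (q - p) if p <> q and p + q = 1, and 2 if
   p = q = 1/2. *)
Definition logsob p q : R :=
  let y := (ln p - ln q) / 2 in 2 * xsinhV y * cosh y.

Lemma logsob_gt0 p q : 0 < logsob p q.
Proof.
rewrite /logsob; apply: mulr_gt0; last exact: cosh_gt0.
by rewrite mulr_gt0 ?xsinhV_gt0.
Qed.

(* The quadratic form in (a, b) obtained by moving everything to the right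
   hand side is nonnegative iff sqrt (c^2 + z^2) <= c cosh y + ln cosh z -
   ln cosh y, where e^(2y) = p/q, e^(2z) = pA/(qB) and c = y / sinh y. *)
Lemma two_point_logsob p q A B a b : 0 < p -> 0 < q -> p + q = 1 ->
  0 < A -> 0 < B ->
  p * a ^+ 2 * (ln A - ln (p * A + q * B)) +
  q * b ^+ 2 * (ln B - ln (p * A + q * B)) <=
  logsob p q * (p * q * (a - b) ^+ 2).
Proof.
move=> p0 q0 pq A0 B0; rewrite /logsob.
have S0 : 0 < p * A + q * B by rewrite addr_gt0// mulr_gt0.
set S := p * A + q * B in S0 *.
set y := (ln p - ln q) / 2.
pose z := (ln (p * A) - ln (q * B)) / 2.
have pA0 : 0 < p * A by rewrite mulr_gt0.
have qB0 : 0 < q * B by rewrite mulr_gt0.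
have := ln_cosh_ge y z.
have c0 := xsinhV_gt0 y; have := xsinhVE y.
set c := xsinhV y in c0 *.
rewrite {2}/z {2}/y !ln_cosh_ln// pq -/S.
rewrite (lnM _ (_ : 2^-1 \is Num.pos)) ?posrE//.
rewrite (lnM _ (_ : 2^-1 \is Num.pos)) ?posrE// ln1.
have -> : ln (p * A) = ln p + ln A by rewrite lnM ?posrE.
have -> : ln (q * B) = ln q + ln B by rewrite lnM ?posrE.
have zE : z = y + (ln A - ln B) / 2.
  by rewrite /z /y !lnM ?posrE//; field.
have E1 : p = expR (ln p / 2) ^+ 2.
  by rewrite -expRM_natl mulrC divfK// lnK ?posrE.
have E2 : q = expR (ln q / 2) ^+ 2.
  by rewrite -expRM_natl mulrC divfK// lnK ?posrE.
have chE : cosh y = (expR (ln p / 2) * expR (ln q / 2))^-1 / 2.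
  by rewrite /y cosh_ln// pq -expRD -expRN mulrC; congr (expR _ * _); field.
have shE : sinh y = (p - q) * cosh y.
  by rewrite /y sinh_ln// cosh_ln// pq; field.
rewrite shE chE.
have x10 := expR_gt0 (ln p / 2); have x20 := expR_gt0 (ln q / 2).
set x1 := expR (ln p / 2) in E1 chE x10 *.
set x2 := expR (ln q / 2) in E2 chE x20 *.
have -> : (ln p + ln A - (ln q + ln B)) / 2 = z by rewrite zE /y; field.
rewrite -/y => yE zle.
(* Here r^2 = p a^2 and w^2 = q b^2; [Wle] will read sqrt (c^2 + z^2) <= e + K with e = c cosh y and
   K = ln cosh z - ln cosh y. *)
set r := x1 * a; set w := x2 * b; set T := Num.sqrt _ in zle.
have Wle : T <= c * ((x1 * x2)^-1 / 2) + (ln S - (ln A + ln B) / 2) by lra.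
set e := c * _ in Wle; set K := ln S - _ in Wle.
have x12 : x1 ^+ 2 + x2 ^+ 2 = 1 by rewrite -E1 -E2.
(* As y = c sinh y, e - y = c exp(-y) and e + y = c exp(y), where exp(y) = x1 / x2; the squares in
   the energy term thus become (e - y) r^2 and (e + y) w^2. *)
have uE : c * x2 = (e - y) * x1.
  rewrite (_ : e - y = e * (x1 ^+ 2 + x2 ^+ 2 - (p - q))); last first.
    by rewrite x12 /e -yE; ring.
  rewrite /e E1 E2; field.
  by rewrite !gt_eqF.
have vE : c * x1 = (e + y) * x2.
  rewrite (_ : e + y = e * (x1 ^+ 2 + x2 ^+ 2 + (p - q))); last first.
    by rewrite x12 /e -yE; ring.
  rewrite /e E1 E2; field.
  by rewrite !gt_eqF.
have -> : ln A - ln S = z - y - K by rewrite /K zE; field.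
have -> : ln B - ln S = - (z - y) - K by rewrite /K zE; field.
have -> : 2 * c * ((x1 * x2)^-1 / 2) * (p * q * (a - b) ^+ 2) =
    (c * x2) * x1 * a ^+ 2 + (c * x1) * x2 * b ^+ 2 - 2 * c * (r * w).
  rewrite /r /w E1 E2; field.
  by rewrite !gt_eqF.
rewrite uE vE -subr_ge0.
have -> : (e - y) * x1 * x1 * a ^+ 2 + (e + y) * x2 * x2 * b ^+ 2 -
    2 * c * (r * w) - (p * a ^+ 2 * (z - y - K) + q * b ^+ 2 * (- (z - y) - K))
  = (e + K) * (r ^+ 2 + w ^+ 2) - (z * (r ^+ 2 - w ^+ 2) + 2 * c * (r * w)).
  by rewrite /r /w E1 E2; ring.
rewrite subr_ge0; apply: le_trans (rotation_le c z r w) _.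
by rewrite ler_wpM2r// addr_ge0 ?sqr_ge0.
Qed.

End Hyperbolic.

(** * Comparison of the three choices of rho with the logarithmic Sobolev constant *)

Section LogSobolevConstant.
Context {R : realType}.
Implicit Types p q x y u t : R.

Lemma sinhD x y : sinh (x + y) = sinh x * cosh y + cosh x * sinh y.
Proof. by rewrite /sinh /cosh opprD !expRD; field. Qed.

Lemma coshD x y : cosh (x + y) = cosh x * cosh y + sinh x * sinh y.
Proof. by rewrite /sinh /cosh opprD !expRD; field. Qed.

(** At t = 0 both sides vanish. The right side has derivative coth (u + t) + coth (u - t) = sinh
    (2u) / (sinh^2 u - sinh^2 t), which is at least its value 2 coth u at t = 0. *)
Lemma ln_sinh_ratio_ge u t : 0 < u -> 0 <= t < u ->
  2 * (cosh u / sinh u) * t <= ln (sinh (u + t)) - ln (sinh (u - t)).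
Proof.
move=> u0 /andP[t0 tu]; rewrite -subr_ge0.
set k := 2 * _.
pose F := fun s : R => ln (sinh (u + s)) - ln (sinh (u - s)) - k * s.
pose dF := fun s : R =>
  cosh (u + s) / sinh (u + s) + cosh (u - s) / sinh (u - s) - k.
have <- : F 0 = 0 by rewrite /F addr0 subr0 mulr0 subr0 subrr.
have su0 : 0 < sinh u by rewrite sinh_gt0.
have pos s : 0 <= s <= t -> 0 < sinh (u + s) /\ 0 < sinh (u - s).
  by rewrite !sinh_gt0 => /andP[? ?]; split; lra.
apply: (@le_of_derive_ge0 R F dF) => // s /pos[sp sm].
  have d1 : is_derive s 1 (fun r : R => u + r) 1.
    rewrite (_ : (fun _ => _) = cst u + (id : R -> R))//.
    by apply: is_derive_eq; rewrite add0r.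
  have d2 : is_derive s 1 (fun r : R => u - r) (-1).
    rewrite (_ : (fun _ => _) = cst u - (id : R -> R))//.
    by apply: is_derive_eq; rewrite sub0r.
  have e1 : is_derive s 1 (@sinh R \o (fun r : R => u + r)) (cosh (u + s) * 1).
    exact: is_derive1_comp.
  have e2 : is_derive s 1 (@sinh R \o (fun r : R => u - r)) (cosh (u - s) * -1).
    exact: is_derive1_comp.
  have f1 := @is_derive1_comp R (@ln R) _ s _ _ (is_derive1_ln sp) e1.
  have f2 := @is_derive1_comp R (@ln R) _ s _ _ (is_derive1_ln sm) e2.
  have f3 : is_derive s 1 (k \*: (id : R -> R)) k.
    by apply: is_derive_eq; rewrite /GRing.scale/= mulr1.
  apply: (is_derive_eq (is_deriveB (is_deriveB f1 f2) f3)).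
  by rewrite /dF; field; rewrite !gt_eqF.
have eprod : sinh (u + s) * sinh (u - s) = sinh u ^+ 2 - sinh s ^+ 2.
  rewrite !sinhD coshN sinhN.
  have /eqP := cosh2_sinh2 u; rewrite subr_eq => /eqP eu.
  have /eqP := cosh2_sinh2 s; rewrite subr_eq => /eqP es.
  transitivity (sinh u ^+ 2 * cosh s ^+ 2 - cosh u ^+ 2 * sinh s ^+ 2).
    by ring.
  by rewrite eu es; ring.
have enum : cosh (u + s) * sinh (u - s) + cosh (u - s) * sinh (u + s) =
    2 * (sinh u * cosh u).
  rewrite !sinhD !coshD coshN sinhN.
  transitivity (2 * (sinh u * cosh u) * (cosh s ^+ 2 - sinh s ^+ 2)).
    by ring.
  by rewrite cosh2_sinh2 mulr1.
have -> : dF s = 2 * (sinh u * cosh u) / (sinh (u + s) * sinh (u - s)) - k.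
  by rewrite -enum /dF; field; rewrite !gt_eqF.
rewrite subr_ge0 ler_pdivlMr ?(mulr_gt0 sp sm)// eprod /k.
have -> : 2 * (cosh u / sinh u) * (sinh u ^+ 2 - sinh s ^+ 2) =
  2 * (sinh u * cosh u) - 2 * (cosh u / sinh u) * sinh s ^+ 2.
  by field; rewrite gt_eqF.
rewrite gerBl mulr_ge0 ?sqr_ge0//.
by have := divr_gt0 (cosh_gt0 u) su0; lra.
Qed.

Lemma logsobC p q : logsob p q = logsob q p.
Proof.
rewrite /logsob -opprB mulNr xsinhVN coshN.
by congr (_ * _ * _); congr (_ _).
Qed.

(** With h half the log-ratio and c = [xsinhV h], half of the left side is c cosh h = h + c exp(-h),
    and c <= 1. *)
Lemma logsob_le p q : 0 < p <= q -> logsob p q <= 2 + (ln q - ln p).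
Proof.
move=> /andP[p0 pq]; have q0 := lt_le_trans p0 pq.
rewrite logsobC /logsob; set h := (ln q - ln p) / 2.
have -> : ln q - ln p = 2 * h by rewrite /h mulrC divfK.
have h0 : 0 <= h by rewrite /h divr_ge0// subr_ge0 ler_ln.
suff : xsinhV h * cosh h <= 1 + xsinhV h * sinh h by rewrite xsinhVE; lra.
rewrite -lerBlDr -mulrBr.
have -> : cosh h - sinh h = expR (- h) by rewrite /cosh /sinh; field.
have c1 : xsinhV h <= 1.
  rewrite /xsinhV; case: eqP => // /eqP hn0.
  have hp : 0 < h by rewrite lt_def hn0.
  by rewrite ler_pdivrMr ?sinh_gt0// mul1r le_sinh.
rewrite -[leRHS]mulr1 ler_pM// ?expR_ge0 ?(ltW (xsinhV_gt0 _))//.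
by rewrite expR_le1 oppr_le0.
Qed.

Lemma lam_bounds p : 0 < p < 1 -> 0 < lam p <= 1 - lam p.
Proof.
rewrite /lam => /andP[p0 p1].
by case: (leP p (1 - p)) => ?; apply/andP; split; lra.
Qed.

Lemma logsob_lam p : logsob p (1 - p) = logsob (lam p) (1 - lam p).
Proof.
rewrite /lam; case: (leP p (1 - p)) => // _.
by rewrite logsobC; congr logsob; ring.
Qed.

(** With q = exp(x) + 1 this is 1 - 2/q, the form called for by the exponent in [rho_i] and the
    arguments of sinh in [rho_ii]. *)
Lemma tanh_halfE x : tanh (x / 2) = 1 - 2 * (expR x + 1)^-1.
Proof.
rewrite /tanh /sinh /cosh expRN.
have e : expR x = expR (x / 2) ^+ 2 by rewrite -expRM_natl mulrC divfK.
have := expR_gt0 (x / 2); rewrite e; set z := expR (x / 2) => z0.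
have z2 : 0 < z ^+ 2 + 1 by rewrite addr_gt0 ?exprn_gt0.
by field; rewrite !gt_eqF//.
Qed.

Lemma tanh_half_bounds x : 0 < x ->
  [/\ 0 < tanh (x / 2), tanh (x / 2) < 1 & 2 * tanh (x / 2) <= x].
Proof.
move=> x0; have e1 : 1 < expR x by rewrite expR_gt1.
split.
- by rewrite /tanh divr_gt0 ?cosh_gt0// sinh_gt0 divr_gt0.
- by rewrite tanh_halfE gtrBl mulr_gt0// invr_gt0; lra.
- have h : sinh (x / 2) <= x * cosh (x / 2) / 2.
    by rewrite mulrAC; apply: sinh_le_xcosh; rewrite divr_ge0// ltW.
  by rewrite /tanh mulrA ler_pdivrMr ?cosh_gt0// mulrC -ler_pdivlMr.
Qed.

(** One quotient of [C0] is compared with 1/C in cleared form, which also yields the positivity of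
    its denominator. *)
Lemma logsob_term_bound p (rho : R -> R) x : 0 < p < 1 -> admissible p rho ->
  0 < x ->
  logsob p (1 - p) * tanh (x / 2) <= x - ln (rho2 rho x ^+ 2).
Proof.
move=> hp hrho x0; rewrite logsob_lam.
have [t0 t1 tx] := tanh_half_bounds x0.
have e1 : 1 < expR x by rewrite expR_gt1.
have q2 : 2 <= expR x + 1 by lra.
have /andP[l0 l1] := lam_bounds hp; have m0 := lt_le_trans l0 l1.
set l := lam p in l0 l1 m0 *.
have Cle : logsob l (1 - l) <= 2 + (ln (1 - l) - ln l).
  by apply: logsob_le; rewrite l0.
have lnm : ln (1 - l) <= 0 by rewrite ln_le0// lerBlDr lerDl ltW.
have lnl : ln l <= ln (1 - l) by rewrite ler_ln.
set C := logsob _ _ in Cle *; set t := tanh _ in t0 t1 tx *.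
have Ctle : C * t <= 2 * t + (ln (1 - l) - ln l) * t.
  by rewrite -mulrDl ler_wpM2r// ltW.
rewrite /rho2; case: hrho => -> //.
(* Kind (i): ln rho^2 = t ln l, and 2t <= x absorbs the additive 2 of [logsob_le]. *)
- rewrite /rho_i -/l lnXn ?powR_gt0// ln_powR.
  have -> : (2^-1 - (expR x + 1)^-1) * ln l *+ 2 = t * ln l.
    rewrite /t tanh_halfE; field; rewrite gt_eqF//; lra.
  suff : t * (ln (1 - l)) <= 0 by lra.
  by rewrite pmulr_rle0.
(* Kind (ii): for l = 1/2 the claim reduces to C t <= 2t <= x. *)
- rewrite /rho_ii -/l; case: eqP => [lE|/eqP ln2].
    rewrite expr1n ln1 subr0; have lE' : 1 - l = l by rewrite lE; lra.
    by rewrite lE' subrr mul0r addr0 in Ctle; lra.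
  have ll : l < 1 - l.
    by rewrite lt_def l1 andbT; apply: contra_neq ln2 => e; lra.
  have lnll : ln l < ln (1 - l) by rewrite ltr_ln.
  rewrite ln_div ?posrE//.
  set u := ln (1 - l) - ln l; have u0 : 0 < u by rewrite subr_gt0.
  have -> : - ((expR x + 1)^-1 * (ln l - ln (1 - l))) = u / 2 - t * (u / 2).
    rewrite /t tanh_halfE /u; field; rewrite gt_eqF//; lra.
  have -> : - ((1 - (expR x + 1)^-1) * (ln l - ln (1 - l))) =
      u / 2 + t * (u / 2).
    rewrite /t tanh_halfE /u; field; rewrite gt_eqF//; lra.
  have h0 : 0 < u / 2 by rewrite divr_gt0.
  set h := u / 2 in h0 *.
  have th0 : 0 < t * h by rewrite mulr_gt0.
  have thh : t * h < h by rewrite gtr_pMl.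
  have sm : 0 < sinh (h - t * h) by rewrite sinh_gt0 subr_gt0.
  have sp : 0 < sinh (h + t * h) by rewrite sinh_gt0 addr_gt0.
  have sr := divr_gt0 sm sp.
  (* rho^2 is exp(x) times sinh (h - th) / sinh (h + th), so x cancels; the remaining log-ratio is
     at least its tangent 2 (coth h) t h = C t. *)
  rewrite addrK exprMn !sqr_sqrtr ?(ltW sr) ?expR_ge0//.
  rewrite lnM ?posrE ?expR_gt0// expRK ln_div ?posrE//.
  have := @ln_sinh_ratio_ge h (t * h) h0.
  rewrite (ltW th0) thh => /(_ isT).
  have -> : 2 * (cosh h / sinh h) * (t * h) = C * t.
    rewrite /C logsobC /logsob -/u -/h /xsinhV gt_eqF//; field.
    by rewrite gt_eqF// sinh_gt0.
  lra.
(* Kind (iii): -ln rho^2 = ln (1 - l) - ln l, which dominates t times itself since t < 1. *)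
- rewrite /rho_iii -/l sqr_sqrtr ?divr_ge0 ?(ltW l0) ?(ltW m0)//.
  rewrite ln_div ?posrE//.
  have := ler_wpM2l (_ : 0 <= ln (1 - l) - ln l) (ltW t1).
  by rewrite subr_ge0 lnl mulr1 => /(_ isT); lra.
Qed.

Lemma C0_le p (rho : R -> R) : 0 < p < 1 -> admissible p rho ->
  (C0 rho <= ((logsob p (1 - p))^-1)%:E)%E.
Proof.
move=> hp hrho; apply: ge_ereal_sup => _ [x /= x0 <-].
have [t0 _ _] := tanh_half_bounds x0.
have := logsob_term_bound hp hrho x0.
have C0 := logsob_gt0 p (1 - p).
rewrite lee_fin => h; have D0 : 0 < x - ln (rho2 rho x ^+ 2).
  by apply: lt_le_trans h; rewrite mulr_gt0.
by rewrite ler_pdivrMr// ler_pdivlMl.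
Qed.

End LogSobolevConstant.

(** * Expectation on the biased cube and tensorization of log-Sobolev *)

Section CubeExpectation.
Context {R : realType} (p : R) (n : nat).
Implicit Types (f g h : cube n -> R) (i j : 'I_n) (x y : cube n) (b : bool).
Implicit Type s : seq 'I_n.

Lemma set_coordE x i b j : set_coord x i b j = if j == i then b else x j.
Proof. by rewrite ffunE. Qed.

Lemma set_coord_set x i b b' :
  set_coord (set_coord x i b) i b' = set_coord x i b'.
Proof. by apply/ffunP => j; rewrite !set_coordE; case: eqP. Qed.

Lemma set_coord_id x i : set_coord x i (x i) = x.
Proof. by apply/ffunP => j; rewrite set_coordE; case: eqP => // ->. Qed.

Lemma set_coordC x i j b b' : i != j ->
  set_coord (set_coord x i b) j b' = set_coord (set_coord x j b') i b.
Proof.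
move=> ij; apply/ffunP => k; rewrite !set_coordE.
by case: (eqVneq k j) => [->|//]; rewrite eq_sym (negbTE ij).
Qed.

Lemma mass_set_coord x i b :
  biased_mass p (set_coord x i b) * bias p (x i) = biased_mass p x * bias p b.
Proof.
rewrite /biased_mass (bigD1 i)//= [in RHS](bigD1 i)//= set_coordE eqxx.
rewrite mulrAC [RHS]mulrAC [bias p b * _]mulrC; congr (_ * _).
by apply: eq_bigr => j ji; rewrite set_coordE (negbTE ji).
Qed.

Lemma sum_bias : \sum_(b : bool) bias p b = 1.
Proof. by rewrite big_bool /bias /= addrC subrK. Qed.

Lemma sum_mass : \sum_(x : cube n) biased_mass p x = 1.
Proof.
transitivity (\prod_(i < n) \sum_(b : bool) bias p b).
  by rewrite bigA_distr_bigA.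
by rewrite big1// => i _; rewrite sum_bias.
Qed.

Lemma Ex_cst (c : R) : Ex p (fun _ : cube n => c) = c.
Proof. by rewrite /Ex -mulr_suml sum_mass mul1r. Qed.

Lemma ExD f g : Ex p (fun x => f x + g x) = Ex p f + Ex p g.
Proof. by rewrite /Ex -big_split/=; apply: eq_bigr => x _; rewrite mulrDr. Qed.

Lemma ExZ (c : R) f : Ex p (fun x => c * f x) = c * Ex p f.
Proof. by rewrite /Ex mulr_sumr; apply: eq_bigr => x _; rewrite mulrCA. Qed.

Lemma ExN f : Ex p (fun x => - f x) = - Ex p f.
Proof. by rewrite /Ex -sumrN; apply: eq_bigr => x _; rewrite mulrN. Qed.

Lemma ExB f g : Ex p (fun x => f x - g x) = Ex p f - Ex p g.
Proof. by rewrite ExD ExN. Qed.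

Lemma eq_Ex f g : f =1 g -> Ex p f = Ex p g.
Proof. by move=> fg; apply: eq_bigr => x _; rewrite fg. Qed.

Lemma Ex_coordE i f x : Ex_coord p i f x =
  p * f (set_coord x i true) + (1 - p) * f (set_coord x i false).
Proof. by rewrite /Ex_coord big_bool. Qed.

Lemma Ex_coord_set i f x b :
  Ex_coord p i f (set_coord x i b) = Ex_coord p i f x.
Proof. by rewrite !Ex_coordE !set_coord_set. Qed.

Lemma Ex_coord_fixed i f : (forall x b, f (set_coord x i b) = f x) ->
  Ex_coord p i f = f.
Proof. by move=> fi; apply/funext => x; rewrite Ex_coordE !fi; ring. Qed.

Lemma Ex_coord_id i f : Ex_coord p i (Ex_coord p i f) = Ex_coord p i f.
Proof. by apply: Ex_coord_fixed => x b; exact: Ex_coord_set. Qed.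

Lemma Ex_coordC i j f :
  Ex_coord p i (Ex_coord p j f) = Ex_coord p j (Ex_coord p i f).
Proof.
have [->//|ij] := eqVneq i j.
apply/funext => x; rewrite !Ex_coordE.
by rewrite !(set_coordC x _ _ ij); ring.
Qed.

Lemma Ex_coordB i f g :
  Ex_coord p i (f \- g) = Ex_coord p i f \- Ex_coord p i g.
Proof. by apply/funext => x /=; rewrite !Ex_coordE /=; ring. Qed.

Lemma Ex_coordM i f g : Ex_coord p i (fun x => f x * Ex_coord p i g x) =
  (fun x => Ex_coord p i f x * Ex_coord p i g x).
Proof.
by apply/funext => x; rewrite Ex_coordE !Ex_coord_set (Ex_coordE i f); ring.
Qed.

(** Resampling: exchanging [x i] with an independent biased bit is an involution preserving the
    product measure. *)
Lemma Ex_Ex_coord i f : Ex p (Ex_coord p i f) = Ex p f.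
Proof.
pose sw (u : cube n * bool) := (set_coord u.1 i u.2, u.1 i).
have swK : involutive sw.
  move=> [x b]; rewrite /sw /= set_coord_set set_coord_id.
  by rewrite set_coordE eqxx.
transitivity (\sum_(u : cube n * bool)
    biased_mass p u.1 * bias p u.2 * f (set_coord u.1 i u.2)).
  rewrite -(pair_bigA _ (fun x b =>
    biased_mass p x * bias p b * f (set_coord x i b)))/=.
  apply: eq_bigr => x _; rewrite mulr_sumr.
  by apply: eq_bigr => b _; rewrite mulrA.
rewrite (reindex_inj (inv_inj swK)) /=.
transitivity (\sum_(u : cube n * bool) biased_mass p u.1 * bias p u.2 * f u.1).
  apply: eq_bigr => -[x b] _ /=.
  by rewrite set_coord_set set_coord_id mass_set_coord.
rewrite -(pair_bigA _ (fun x b => biased_mass p x * bias p b * f x))/=.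
by apply: eq_bigr => x _; rewrite -mulr_suml -mulr_sumr sum_bias mulr1.
Qed.

(** Pythagoras: E_i is an orthogonal projection, as E[f E_i f] = E[(E_i f)^2]. *)
Lemma Ex_sqr_centered i f :
  Ex p (fun x => centered p i f x ^+ 2) =
  Ex p (fun x => f x ^+ 2) - Ex p (fun x => Ex_coord p i f x ^+ 2).
Proof.
have e : Ex p (fun x => f x * Ex_coord p i f x) =
    Ex p (fun x => Ex_coord p i f x ^+ 2).
  by rewrite -(Ex_Ex_coord i) Ex_coordM.
transitivity (Ex p (fun x => f x ^+ 2 - 2 * (f x * Ex_coord p i f x) +
    Ex_coord p i f x ^+ 2)).
  by apply: eq_Ex => x; rewrite /centered /=; ring.
by rewrite ExD ExB ExZ e; ring.
Qed.

(** The coordinates form a list rather than a set, so that suffixes of the enumeration of ['I_n]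
    give the martingale filtration. *)
Definition Ex_coords s f : cube n -> R := foldr (@Ex_coord R p n) f s.

Lemma Ex_coords_coord s i f :
  Ex_coord p i (Ex_coords s f) = Ex_coords s (Ex_coord p i f).
Proof. by elim: s => //= j s ih; rewrite Ex_coordC ih. Qed.

Lemma Ex_coordsB s f g :
  Ex_coords s (f \- g) = Ex_coords s f \- Ex_coords s g.
Proof. by elim: s => //= j s ->; rewrite Ex_coordB. Qed.

Lemma centered_coords s i f :
  centered p i (Ex_coords s f) = Ex_coords s (centered p i f).
Proof. by rewrite /centered Ex_coordsB Ex_coords_coord. Qed.

Lemma Ex_Ex_coords s f : Ex p (Ex_coords s f) = Ex p f.
Proof. by elim: s => //= i s ih; rewrite Ex_Ex_coord. Qed.

(** By commutation E_i can be moved to its own occurrence in [s], where it is idempotent. *)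
Lemma Ex_coords_set s f i b x : i \in s ->
  Ex_coords s f (set_coord x i b) = Ex_coords s f x.
Proof.
move=> si; suff <- : Ex_coord p i (Ex_coords s f) = Ex_coords s f.
  exact: Ex_coord_set.
elim: s si => //= j s ih; rewrite inE => /predU1P[->|/ih e].
  exact: Ex_coord_id.
by rewrite Ex_coordC e.
Qed.

(** The left side depends on no coordinate, so it is constant and equals its own mean, which is that
    of f. *)
Lemma Ex_coords_enum f : Ex_coords (enum 'I_n) f = fun=> Ex p f.
Proof.
set h := Ex_coords _ _.
have hset x i b : h (set_coord x i b) = h x.
  by apply: Ex_coords_set; rewrite mem_enum.
have hcst x y : h x = h y.
  pose upd s := foldr (fun i z => set_coord z i (y i)) x s.
  have hupd s : h (upd s) = h x by elim: s => //= i s; rewrite hset.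
  rewrite -(hupd (enum 'I_n)); congr h; apply/ffunP => j.
  have : j \in enum 'I_n by rewrite mem_enum.
  rewrite /upd; elim: (enum _) => //= i s ih; rewrite inE set_coordE.
  by case: eqP => [->|_ /ih].
apply/funext => x; rewrite -(Ex_Ex_coords (enum 'I_n) f) -/h.
by rewrite (eq_Ex (fun y => hcst y x)) Ex_cst.
Qed.

Context (hp : 0 < p < 1).

Lemma bias_gt0 b : 0 < bias p b.
Proof. by case/andP: hp => ? ?; case: b => //=; rewrite subr_gt0. Qed.

Lemma mass_gt0 x : 0 < biased_mass p x.
Proof. by apply: prodr_gt0 => i _; exact: bias_gt0. Qed.

Lemma le_Ex f g : (forall x, f x <= g x) -> Ex p f <= Ex p g.
Proof.
by move=> fg; apply: ler_sum => x _; rewrite ler_wpM2l// ltW// mass_gt0.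
Qed.

Lemma Ex_ge0 f : (forall x, 0 <= f x) -> 0 <= Ex p f.
Proof.
by move=> f0; apply: sumr_ge0 => x _; rewrite mulr_ge0// ltW// mass_gt0.
Qed.

Lemma Ex_coord_gt0 i f : (forall x, 0 < f x) -> forall x, 0 < Ex_coord p i f x.
Proof.
move=> f0 x; case/andP: hp => ? ?.
by rewrite Ex_coordE addr_gt0 ?mulr_gt0 ?subr_gt0.
Qed.

Lemma Ex_coords_gt0 s f : (forall x, 0 < f x) ->
  forall x, 0 < Ex_coords s f x.
Proof. by move=> f0; elim: s => //= i s ih; exact: Ex_coord_gt0. Qed.

Lemma Ex_norm_coord i f :
  Ex p (fun x => `|Ex_coord p i f x|) <= Ex p (fun x => `|f x|).
Proof.
rewrite -[leRHS](Ex_Ex_coord i); apply: le_Ex => x.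
case/andP: hp => p0 p1; have q0 : 0 < 1 - p by rewrite subr_gt0.
rewrite !Ex_coordE (le_trans (ler_normD _ _))//.
by rewrite !normrM (gtr0_norm p0) (gtr0_norm q0).
Qed.

Lemma Ex_norm_coords s f :
  Ex p (fun x => `|Ex_coords s f x|) <= Ex p (fun x => `|f x|).
Proof. by elim: s => //= i s; apply: le_trans; exact: Ex_norm_coord. Qed.

Let C := logsob p (1 - p).

(** On each fibre of coordinate i this is the two-point inequality, A, B being the values of h and
    a, b those of g; the fibre mean of the squared [centered p i g] is p (1 - p) (a - b)^2. *)
Lemma logsob_coord i g h : (forall x, 0 < h x) ->
  Ex p (fun x => g x ^+ 2 * (ln (h x) - ln (Ex_coord p i h x))) <=
  C * Ex p (fun x => centered p i g x ^+ 2).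
Proof.
move=> h0; rewrite -ExZ -[leLHS](Ex_Ex_coord i) -[leRHS](Ex_Ex_coord i).
apply: le_Ex => x; case/andP: hp => p0 p1.
have q0 : 0 < 1 - p by rewrite subr_gt0.
rewrite [leLHS]Ex_coordE [leRHS]Ex_coordE /centered /= !Ex_coord_set.
rewrite (Ex_coordE i h) (Ex_coordE i g).
have := @two_point_logsob R p (1 - p) _ _ (g (set_coord x i true))
  (g (set_coord x i false)) p0 q0 _ (h0 (set_coord x i true))
  (h0 (set_coord x i false)).
rewrite addrC subrK -/C => /(_ erefl) two.
rewrite !(mulrA _ (_ ^+ 2)); apply: le_trans two _.
by rewrite le_eqVlt; apply/orP; left; apply/eqP; ring.
Qed.

(* Telescoping ln h - ln (E_s h) along the successive conditional expectations
   of h reduces the inequality to one coordinate at a time. *)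
Lemma logsob_coords s g h : (forall x, 0 < h x) ->
  Ex p (fun x => g x ^+ 2 * (ln (h x) - ln (Ex_coords s h x))) <=
  C * \sum_(i <- s) Ex p (fun x => centered p i g x ^+ 2).
Proof.
move=> h0; elim: s => [|i s ih].
  rewrite big_nil mulr0 /= (@eq_Ex _ (fun=> 0)) ?Ex_cst// => x.
  by rewrite subrr mulr0.
rewrite big_cons mulrDr; apply: le_trans (lerD (logsob_coord i g
  (Ex_coords_gt0 s h0)) ih).
by rewrite -ExD le_eqVlt; apply/orP; left; apply/eqP/eq_Ex => x /=; ring.
Qed.

(** For h = g^2 the left side would be Ent(g^2); a free positive h avoids logarithms at the zeros of
    g. *)
Lemma logsob_cube g h : (forall x, 0 < h x) ->
  Ex p (fun x => g x ^+ 2 * (ln (h x) - ln (Ex p h))) <=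
  C * \sum_(i < n) Ex p (fun x => centered p i g x ^+ 2).
Proof.
move=> h0; have := logsob_coords (enum 'I_n) g h0.
by rewrite Ex_coords_enum big_enum.
Qed.

End CubeExpectation.

(** * Martingale differences and the Falik-Samorodnitsky inequality *)

Section FalikSamorodnitsky.
Context {R : realType} (p : R) (n : nat).
Implicit Types (f g : cube n -> R) (i j : 'I_n) (x : cube n).

Lemma centeredC i j f : centered p i (centered p j f) =
  centered p j (centered p i f).
Proof.
rewrite /centered !Ex_coordB (Ex_coordC _ i j).
by apply/funext => x /=; ring.
Qed.

(** The martingale difference E[f | x_0, ..., x_i] - E[f | x_0, ..., x_(i-1)]. *)
Definition mdiff f i : cube n -> R :=
  centered p i (Ex_coords p (drop i.+1 (enum 'I_n)) f).

(** By Pythagoras each term is a difference of second moments of consecutive conditional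
    expectations; the sum telescopes from (E f)^2 to E[f^2]. *)
Lemma sum_sqr_mdiff f : \sum_(i < n) Ex p (fun x => mdiff f i x ^+ 2) = Var p f.
Proof.
pose E k := Ex p (fun x => Ex_coords p (drop k (enum 'I_n)) f x ^+ 2).
transitivity (\sum_(i < n) (E i.+1 - E i)).
  apply: eq_bigr => i _; rewrite /mdiff Ex_sqr_centered /E.
  suff -> : drop i (enum 'I_n) = i :: drop i.+1 (enum 'I_n) by [].
  by rewrite (drop_nth i) ?size_enum_ord// nth_ord_enum.
rewrite -(big_mkord xpredT (fun k => E k.+1 - E k)) telescope_sumr//.
rewrite /E drop0 drop_oversize ?size_enum_ord//= Ex_coords_enum.
by rewrite Ex_cst.
Qed.

Lemma mdiff_coords f i :
  mdiff f i = Ex_coords p (drop i.+1 (enum 'I_n)) (centered p i f).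
Proof. exact: centered_coords. Qed.

Lemma centered_mdiff f i j :
  centered p j (mdiff f i) = mdiff (centered p j f) i.
Proof. by rewrite !mdiff_coords centered_coords centeredC. Qed.

Context (hp : 0 < p < 1).

Lemma Ex_norm_gt0 f : f != (fun=> 0) -> 0 < Ex p (fun x => `|f x|).
Proof.
move=> f0; have [x fx] : exists x, f x != 0.
  apply: contrapT => /forallNP h; move/eqP: f0; apply; apply/funext => x.
  by apply/eqP; rewrite -[_ == _]negbK; apply/negP; exact: h.
rewrite /Ex (bigD1 x)//= ltr_pwDl//.
  by rewrite mulr_gt0 ?(mass_gt0 hp) ?normr_gt0.
by apply: sumr_ge0 => y _; rewrite mulr_ge0 ?normr_ge0 ?(ltW (mass_gt0 hp _)).
Qed.

Lemma Ex_norm_mdiff f i :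
  Ex p (fun x => `|mdiff f i x|) <= Ex p (fun x => `|centered p i f x|).
Proof. by rewrite mdiff_coords; exact: Ex_norm_coords. Qed.

Let C := logsob p (1 - p).
Let energy g := \sum_(j < n) Ex p (fun x => centered p j g x ^+ 2).

Let energy_ge0 g : 0 <= energy g.
Proof.
by apply: sumr_ge0 => j _; apply: (Ex_ge0 hp) => x; exact: sqr_ge0.
Qed.

(* The log-Sobolev inequality is tested on h = (|g| + e)^2, which, unlike
   g^2, never vanishes; the entropy is bounded below with
   ln w >= 1 - 1/(wT) - ln T for T = N / E[g^2]. *)
Lemma ln_L2_L1_approx g (N e : R) : 0 < N -> 0 < e ->
  Ex p (fun x => `|g x|) <= N ->
  let v := Ex p (fun x => g x ^+ 2) in 0 < v ->
  v * (2 * ln v - 2 * ln N - ln (v + 2 * e * N + e ^+ 2)) <= C * energy g.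
Proof.
move=> N0 e0 gN v v0; set Z := v + _ + _.
have Z0 : 0 < Z by rewrite /Z addr_gt0 ?addr_gt0 ?mulr_gt0 ?exprn_gt0.
pose w x := `|g x| + e; have w0 x : 0 < w x by rewrite /w ltr_wpDl.
have h0 x : 0 < w x ^+ 2 by rewrite exprn_gt0.
apply: le_trans (logsob_cube hp g h0).
have EhZ : Ex p (fun x => w x ^+ 2) <= Z.
  have -> : Ex p (fun x => w x ^+ 2) =
      v + 2 * e * Ex p (fun x => `|g x|) + e ^+ 2.
    rewrite -(Ex_cst p n (e ^+ 2)) -ExZ -!ExD; apply: eq_Ex => x.
    by rewrite /w -(real_normK (num_real (g x))); ring.
  by rewrite /Z lerD2r lerD2l ler_wpM2l// mulr_ge0// ltW.
have Eh0 : 0 < Ex p (fun x => w x ^+ 2).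
  rewrite (lt_le_trans (_ : 0 < e ^+ 2)) ?exprn_gt0//.
  rewrite -[leLHS](Ex_cst p n); apply: (le_Ex hp) => x.
  by rewrite ler_sqr ?nnegrE ?(ltW e0) ?(ltW (w0 x))// /w lerDr.
set T := N / v; have T0 : 0 < T by rewrite divr_gt0.
have lnT : ln T = ln N - ln v by rewrite ln_div ?posrE.
have lnEh : ln (Ex p (fun x => w x ^+ 2)) <= ln Z by rewrite ler_ln.
apply: (@le_trans _ _ (Ex p (fun x =>
    (2 - 2 * ln T - ln Z) * g x ^+ 2 - 2 / T * `|g x|))); last first.
  apply: (le_Ex hp) => x.
  rewrite lnXn//.
  have wT : 0 < w x * T by apply: mulr_gt0.
  have l1 : 1 - (w x * T)^-1 <= ln (w x) + ln T.
    have := @ln_leB1 R (w x * T)^-1; rewrite invr_gt0 wT => /(_ isT).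
    by rewrite lnV ?posrE // lnM ?posrE//; lra.
  (* As w >= |g|, g^2 / w is at most |g|; this is where the first moment enters. *)
  have gw : g x ^+ 2 * (w x)^-1 <= `|g x|.
    rewrite ler_pdivrMr// -(real_normK (num_real (g x))) expr2 ler_wpM2l//.
    by rewrite /w lerDl ltW.
  have l2 := ler_wpM2l (sqr_ge0 (g x)) l1.
  have l3 := ler_wpM2l (sqr_ge0 (g x)) lnEh.
  have l4 : g x ^+ 2 * (w x * T)^-1 <= `|g x| / T.
    by rewrite invfM mulrA ler_wpM2r// invr_ge0 ltW.
  have -> : ln (w x) *+ 2 = 2 * ln (w x) by rewrite mulr_natl.
  have -> : 2 / T * `|g x| = 2 * (`|g x| / T) by ring.
  rewrite mulrBr mulrDr mulr1 in l2.
  set G := g x ^+ 2 in l2 l3 l4 *.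
  set LW := ln (w x) in l2 *; set LZ := ln Z in l3 *.
  set LE := ln (Ex p _) in l3 *; set LT := ln T in l2 *.
  rewrite -subr_ge0.
  have -> : G * (2 * LW - LE) - ((2 - 2 * LT - LZ) * G - 2 * (`|g x| / T)) =
    2 * (G * LW + G * LT - (G - G * (w x * T)^-1)) + (G * LZ - G * LE)
      + 2 * (`|g x| / T - G * (w x * T)^-1) by ring.
  apply: addr_ge0; first apply: addr_ge0.
  - by rewrite mulr_ge0// subr_ge0.
  - by rewrite subr_ge0.
  - by rewrite mulr_ge0// subr_ge0.
rewrite ExB !ExZ -/v lnT.
have l5 : 2 / T * Ex p (fun x => `|g x|) <= 2 * v.
  rewrite /T mulrAC ler_pdivrMr ?divr_gt0//.
  have -> : 2 * v * (N / v) = 2 * N by field; rewrite gt_eqF.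
  by rewrite ler_pM2l.
rewrite -subr_ge0.
have -> : (2 - 2 * (ln N - ln v) - ln Z) * v - 2 / T * Ex p (fun x => `|g x|) -
   v * (2 * ln v - 2 * ln N - ln Z) =
   2 * v - 2 / T * Ex p (fun x => `|g x|) by ring.
by rewrite subr_ge0.
Qed.

(** The case e -> 0 of the approximate form: with Z the perturbed second moment, v (ln Z - ln v) <=
    Z - v, which can be made at most any eps. *)
Lemma ln_L2_L1 g (N : R) : 0 < N -> Ex p (fun x => `|g x|) <= N ->
  Ex p (fun x => g x ^+ 2) * (ln (Ex p (fun x => g x ^+ 2)) - 2 * ln N) <=
  C * energy g.
Proof.
move=> N0 gN; set v := Ex p (fun x => g x ^+ 2).
have C0 : 0 < C := logsob_gt0 _ _.
have : 0 <= v by apply: (Ex_ge0 hp) => x; exact: sqr_ge0.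
rewrite le_eqVlt => /predU1P[<-|v0].
  by rewrite mul0r mulr_ge0 ?energy_ge0 ?(ltW C0).
apply/ler_addgt0Pr => eps eps0.
have D0 : 0 < 2 * N + 1 + eps by rewrite !addr_gt0// mulr_gt0.
(* The summand eps in the denominator ensures e <= 1, whence 2 e N + e^2 <= e (2 N + 1) <= eps. *)
pose e := eps / (2 * N + 1 + eps).
have e0 : 0 < e by rewrite divr_gt0.
have e1 : e <= 1 by rewrite ler_pdivrMr// mul1r lerDr ltW// addr_gt0// mulr_gt0.
have small : 2 * e * N + e ^+ 2 <= eps.
  have e2 : e ^+ 2 <= e by rewrite expr2 ler_piMr// ltW.
  have : e * (2 * N + 1 + eps) = eps by rewrite divfK// gt_eqF.
  have : 0 <= e * eps by rewrite mulr_ge0// ltW.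
  rewrite !mulrDr mulr1 mulrCA -mulrA; lra.
clearbody e; have := ln_L2_L1_approx N0 e0 gN v0; rewrite -/v.
set Z := v + _ + _ => h.
have Z0 : 0 < Z by rewrite /Z addr_gt0 ?addr_gt0 ?mulr_gt0 ?exprn_gt0.
have := ln_leB1 (divr_gt0 Z0 v0); rewrite ln_div ?posrE// => lnZ.
have := ler_wpM2l (ltW v0) lnZ.
rewrite [v * (Z / v - 1)]mulrBr mulr1 [v * (Z / v)]mulrC divfK ?gt_eqF//.
rewrite !mulrBr in h *; rewrite /Z in h *.
set LZ := ln _ in h *; lra.
Qed.

Lemma falik_samorodnitsky f (m : R) : 0 < m -> 0 < Var p f -> (0 < n)%N ->
  (forall i, Ex p (fun x => `|centered p i f x|) <= m) ->
  Var p f * (ln (Var p f) - ln n%:R - 2 * ln m) <= C * energy f.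
Proof.
move=> m0 V0 n0 fm; set V := Var p f in V0 *.
have nR : 0 < n%:R :> R by rewrite ltr0n.
pose v i := Ex p (fun x => mdiff f i x ^+ 2).
have sumv : \sum_(i < n) v i = V by exact: sum_sqr_mdiff.
have C0 : 0 < C := logsob_gt0 _ _.
set t := V / n%:R; have t0 : 0 < t by rewrite divr_gt0.
have lnt : ln t = ln V - ln n%:R by rewrite ln_div ?posrE.
rewrite -lnt.
(* Summing over i first, the j-th parts of the energies add up to the variance of f^(j), which is at
   most E[(f^(j))^2]. *)
apply: (@le_trans _ _ (\sum_(i < n) C * energy (mdiff f i))); last first.
  rewrite -mulr_sumr ler_pM2l// /energy exchange_big/=; apply: ler_sum => j _.
  rewrite (eq_bigr (fun i => Ex p (fun x => mdiff (centered p j f) i x ^+ 2))).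
    by rewrite sum_sqr_mdiff /Var gerBl sqr_ge0.
  by move=> i _; apply: eq_Ex => x; rewrite centered_mdiff.
apply: (@le_trans _ _ (\sum_(i < n) v i * (ln (v i) - 2 * ln m))); last first.
  apply: ler_sum => i _; apply: ln_L2_L1 => //.
  exact: le_trans (Ex_norm_mdiff _ _) (fm i).
(* Jensen's inequality for x ln x: v ln v >= v ln t + v - t, where t is the mean of the [v i], so
   the corrections v - t sum to zero. *)
have -> : V * (ln t - 2 * ln m) =
    \sum_(i < n) (v i * (ln t - 2 * ln m) + (v i - t)).
  rewrite big_split/= -mulr_suml sumv sumrB sumv sumr_const card_ord.
  by rewrite -(mulr_natr t) divfK ?gt_eqF// subrr addr0.
apply: ler_sum => i _.
have : 0 <= v i by apply: (Ex_ge0 hp) => x; exact: sqr_ge0.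
rewrite le_eqVlt => /predU1P[<-|vi0].
  by rewrite !mul0r !add0r oppr_le0 ltW.
have := ln_leB1 (divr_gt0 t0 vi0); rewrite ln_div ?posrE// => lnZ.
have := ler_wpM2l (ltW vi0) lnZ.
rewrite [v i * (t / v i - 1)]mulrBr mulr1 [v i * (t / v i)]mulrC.
rewrite divfK ?gt_eqF//.
rewrite !mulrBr; lra.
Qed.

Lemma Lqnorm1E f : Lqnorm p 1 f = Ex p (fun x => `|f x|).
Proof.
rewrite /Lqnorm invr1 (@eq_Ex _ _ _ _ (fun x => `|f x|)).
  by rewrite powRr1//; exact: (Ex_ge0 hp).
by move=> x; rewrite powRr1.
Qed.

Lemma Lqnorm2E f : Lqnorm p 2 f ^+ 2 = Ex p (fun x => f x ^+ 2).
Proof.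
rewrite /Lqnorm (@eq_Ex _ _ _ _ (fun x => f x ^+ 2)).
  by rewrite powR12_sqrt ?sqr_sqrtr//; apply: (Ex_ge0 hp) => x; exact: sqr_ge0.
by move=> x; rewrite powR_mulrn// real_normK// num_real.
Qed.

Lemma max_L1_ge f i : Ex p (fun x => `|centered p i f x|) <= max_L1 p f.
Proof. by rewrite -Lqnorm1E; exact: le_bigmax. Qed.

Lemma max_L1_ge0 f : 0 <= max_L1 p f.
Proof.
by rewrite /max_L1; elim/big_rec: _ => // i r _ r0; rewrite le_max r0 orbT.
Qed.

Lemma max_ratio_ge0 f : 0 <= max_ratio p f.
Proof.
by rewrite /max_ratio; elim/big_rec: _ => // i r _ r0; rewrite le_max r0 orbT.
Qed.

(** If every f^(i) vanished, so would every martingale difference, and their squared norms add up to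
    the variance. *)
Lemma max_L1_gt0 f : 0 < Var p f -> 0 < max_L1 p f.
Proof.
move=> V0; have : \sum_(i < n) Ex p (fun x => mdiff f i x ^+ 2) != 0.
  by rewrite sum_sqr_mdiff gt_eqF.
apply: contra_neqT; rewrite -leNgt => m0; apply: big1 => i _.
rewrite (@eq_Ex _ _ _ _ (fun=> 0)) ?Ex_cst// => x.
suff -> : mdiff f i = fun=> 0 by rewrite expr0n.
apply/eqP; apply: contraTT m0 => /Ex_norm_gt0 h; rewrite -ltNge.
by apply: lt_le_trans h (le_trans (Ex_norm_mdiff _ _) (max_L1_ge _ _)).
Qed.

Lemma energy_le f :
  \sum_(j < n) Ex p (fun x => centered p j f x ^+ 2) <=
  n%:R * (max_ratio p f * max_L1 p f).
Proof.
have -> : n%:R * (max_ratio p f * max_L1 p f) =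
    \sum_(j < n) max_ratio p f * max_L1 p f.
  by rewrite sumr_const card_ord mulr_natl.
(* Indices with f^(j) = 0 are left out of [max_ratio] but contribute nothing to the energy. *)
apply: ler_sum => j _; have [fj|fj] := eqVneq (centered p j f) (fun=> 0).
  rewrite (@eq_Ex _ _ _ _ (fun=> 0)) ?Ex_cst; last first.
    by move=> x; rewrite fj expr0n.
  by rewrite mulr_ge0 ?max_ratio_ge0 ?max_L1_ge0.
have L0 := Ex_norm_gt0 fj.
apply: (@le_trans _ _ (max_ratio p f * Ex p (fun x => `|centered p j f x|))).
  rewrite -ler_pdivrMr// -Lqnorm2E -Lqnorm1E.
  exact: (le_bigmax_cond _ (fun i =>
    Lqnorm p 2 (centered p i f) ^+ 2 / Lqnorm p 1 (centered p i f))).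
by rewrite ler_wpM2l ?max_ratio_ge0 ?max_L1_ge.
Qed.

Lemma max_L1_ineq f : (0 < n)%N -> 0 < Var p f ->
  Var p f * (ln (Var p f) - ln n%:R - 2 * ln (max_L1 p f)) <=
  C * (n%:R * (max_ratio p f * max_L1 p f)).
Proof.
move=> n0 V0; apply: le_trans (falik_samorodnitsky (max_L1_gt0 V0) V0 n0 _) _.
  exact: max_L1_ge.
by rewrite ler_pM2l ?logsob_gt0// energy_le.
Qed.

End FalikSamorodnitsky.

(** * Extended real limits and growth of logarithms *)

Section LimitBounds.
Context {R : realType}.
Implicit Types (u : nat -> \bar R).

Lemma limn_esup_lt_near u (a : \bar R) : (limn_esup u < a)%E ->
  \forall k \near \oo, (u k < a)%E.
Proof.
move=> /ereal_inf_lt[_ [V FV <-] sa]; near=> k.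
apply: le_lt_trans sa; apply: ereal_sup_ubound; exists k => //.
by near: k.
Unshelve. all: by end_near. Qed.

Lemma limn_einf_ge_near u (a : \bar R) : (\forall k \near \oo, (a <= u k)%E) ->
  (a <= limn_einf u)%E.
Proof.
move=> au; rewrite /limn_einf leeNr.
apply: (@le_trans _ _
  (ereal_sup ((fun k => - u k)%E @` [set k | (a <= u k)%E]))).
  by apply: ereal_inf_lbound; exists [set k | (a <= u k)%E].
by apply: ge_ereal_sup => _ [k /= ak <-]; rewrite leeN2.
Qed.

Lemma limn_esup_ge0 u : (forall k, (0 <= u k)%E) -> (0 <= limn_esup u)%E.
Proof.
move=> u0; apply: le_ereal_inf_tmp => _ [V [N _ NV] <-].
apply: (@le_trans _ _ (u N)) => //; apply: ereal_sup_ubound.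
by exists N => //; apply: NV => /=.
Qed.

(** Reduces a bound on x, possibly +oo, to real numbers k: were y < x, a real strictly between them
    would be positive and contradict the hypothesis. *)
Lemma lee_real_lt (x y : \bar R) : (0 <= y)%E ->
  (forall k : R, 0 < k -> (k%:E < x)%E -> (k%:E <= y)%E) -> (x <= y)%E.
Proof.
move=> y0 h; rewrite leNgt; apply/negP => yx.
have [r yr rx] : exists2 r : R, (y < r%:E)%E & (r%:E < x)%E.
  case: x y y0 yx {h} => [x| |] [y| |]//=.
  - rewrite lte_fin => _ yx; exists ((x + y) / 2); rewrite lte_fin; lra.
  - by move=> _ _; exists (y + 1); rewrite ?ltry// lte_fin ltrDl.
have r0 : 0 < r by rewrite -lte_fin; exact: le_lt_trans yr.
by have := h _ r0 rx; rewrite leNgt yr.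
Qed.

Lemma near_ln_ge (a : R) : \forall k \near \oo, a <= ln (k%:R : R).
Proof.
near=> k; have ka : expR a <= k%:R by near: k; exact: nbhs_infty_ger.
by rewrite -ler_expR lnK// posrE (lt_le_trans (expR_gt0 a)).
Unshelve. all: by end_near. Qed.

Lemma near_lnln_le (c d : R) : 0 < d ->
  \forall k \near \oo, c + 2 * ln (ln (k%:R : R)) <= d * ln (k%:R : R).
Proof.
move=> d0; near=> k.
have L1 : 1 <= ln (k%:R : R) by near: k; exact: near_ln_ge.
have L2 : (c - 2 - 2 * ln (d / 4)) / (d / 2) <= ln (k%:R : R).
  by near: k; exact: near_ln_ge.
set L := ln _ in L1 L2 *; have L0 : 0 < L by lra.
have d4 : 0 < d / 4 by rewrite divr_gt0.
(* At t = d L / 4, ln t <= t - 1 bounds 2 ln L by d L / 2 plus a constant; [L2] lets the other half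
   of d L pay for that constant and c. *)
have := ln_leB1 (mulr_gt0 d4 L0); rewrite lnM ?posrE// => h.
move: L2; rewrite ler_pdivrMr ?divr_gt0// => L2; lra.
Unshelve. all: by end_near. Qed.

End LimitBounds.

(** * The asymptotic lower bound *)

Section Asymptotics.
Context {R : realType} (p : R).
Context (hp : 0 < p < 1).

(** Let L = ln n. A ratio below k would make ln V - L - 2 ln m exceed (1 - d) L, one half of d L
    absorbing ln V and the other ln k and ln L, whereas the energy bound caps it at C k M L = (1 -
    d) L. *)
Lemma ratio_ge n (f : cube n -> R) (k M d : R) :
  1 < ln (n%:R : R) -> 0 < Var p f -> 0 < k -> 0 < M -> 0 < d ->
  logsob p (1 - p) * (k * M) + d = 1 ->
  max_ratio p f <= M ->
  Var p f <= n%:R `^ (d / 2) ->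
  2 * ln k + 2 * ln (ln n%:R) <= d / 2 * ln n%:R ->
  k <= max_L1 p f / (Var p f * (ln (n%:R : R) / n%:R)).
Proof.
move=> L1 V0 k0 M0 d0 CkM fM Vn small; rewrite leNgt; apply/negP => rk.
have n0 : (0 < n)%N.
  by rewrite lt0n; apply/eqP => n0; move: L1; rewrite n0 ln0// ltr10.
have nR : 0 < n%:R :> R by rewrite ltr0n.
have ineq := max_L1_ineq hp n0 V0.
have m0 := max_L1_gt0 hp V0; have r0 := max_ratio_ge0 p f.
have C0 := logsob_gt0 p (1 - p).
set C := logsob _ _ in ineq CkM C0; set V := Var p f in V0 Vn ineq rk.
set m := max_L1 p f in rk ineq m0; set L := ln (n%:R : R) in L1 rk ineq small *.
set r := max_ratio p f in fM r0 ineq.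
have L0 : 0 < L by lra.
have Ln0 : 0 < L / n%:R by rewrite divr_gt0.
have VL0 : 0 < V * (L / n%:R) by rewrite mulr_gt0.
move: rk; rewrite ltr_pdivrMr// => mk.
have lnm : ln m < ln k + (ln V + (ln L - L)).
  have -> : ln k + (ln V + (ln L - L)) = ln (k * (V * (L / n%:R))).
    rewrite (lnM (_ : k \is Num.pos)) ?posrE//.
    rewrite (lnM (_ : V \is Num.pos)) ?posrE//.
    by rewrite ln_div ?posrE.
  by rewrite ltr_ln ?posrE// mulr_gt0.
have lnV : ln V <= d / 2 * L.
  by rewrite -ln_powR ler_ln ?posrE ?powR_gt0.
have nm : n%:R * (r * m) <= n%:R * (M * (k * (V * (L / n%:R)))).
  by rewrite ler_pM2l// ler_pM// ltW.
have : V * (ln V - L - 2 * ln m) <= V * (C * (k * M) * L).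
  apply: le_trans ineq _; apply: (le_trans (ler_wpM2l (ltW C0) nm)).
  rewrite le_eqVlt; apply/orP; left; apply/eqP; field.
  by rewrite gt_eqF.
rewrite ler_pM2l//.
have -> : C * (k * M) * L = L - d * L by rewrite -[X in X - _]mul1r -CkM; ring.
lra.
Qed.

Lemma near_ratio_ge (f : forall n : nat, cube n -> R)
    (hvar : forall n : nat, (0 < n)%N -> 0 < Var p (f n))
    (hsub : forall eps : R, 0 < eps ->
      (fun n : nat => Var p (f n)) =o_\oo (fun n : nat => n%:R `^ eps))
    (k M : R) : 0 < k -> 0 < M -> logsob p (1 - p) * (k * M) < 1 ->
  (M0 p f < M%:E)%E ->
  \forall n \near \oo,
    k <= max_L1 p (f n) / (Var p (f n) * (ln (n%:R : R) / n%:R)).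
Proof.
move=> k0 M_0 CkM fM.
set d := 1 - logsob p (1 - p) * (k * M).
have d0 : 0 < d by rewrite subr_gt0.
have d2 : 0 < d / 2 by rewrite divr_gt0.
near=> n.
have n0 : (0 < n)%N by near: n; exact: nbhs_infty_gt.
apply: (@ratio_ge n (f n) k M d) => //.
- have : 2 <= ln (n%:R : R) by near: n; exact: near_ln_ge.
  by apply: lt_le_trans; rewrite ltr1n.
- exact: hvar.
- by rewrite /d subrKC.
- have : ((max_ratio p (f n))%:E < M%:E)%E.
    by near: n; exact: limn_esup_lt_near.
  by rewrite lte_fin => /ltW.
(* The growth hypothesis at exponent d / 2, with little-o constant 1. *)
- have : `|Var p (f n)| <= 1 * `|(n%:R : R) `^ (d / 2)|.
    by near: n; have /eqoP := hsub _ d2; apply.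
  by rewrite mul1r (ger0_norm (powR_ge0 _ _)) ger0_norm// ltW// hvar.
- by near: n; exact: near_lnln_le.
Unshelve. all: by end_near. Qed.

End Asymptotics.

(* In \bar R, inversion satisfies 0^-1 = +oo and +oo^-1 = 0, and C0 > 0, so
   C0 / M0 is +oo when M0 = 0 and 0 when M0 = +oo. *)
Theorem theorem1 (R : realType) (p : R) (hp : 0 < p < 1)
    (f : forall n : nat, cube n -> R) (rho : R -> R) (hrho : admissible p rho)
    (hvar : forall n : nat, (0 < n)%N -> 0 < Var p (f n))
    (hsub : forall eps : R, 0 < eps ->
      (fun n : nat => Var p (f n)) =o_\oo (fun n : nat => n%:R `^ eps)) :
  (C0 rho / M0 p f <=
    limn_einf (fun n : nat =>
      (max_L1 p (f n) / (Var p (f n) * (ln (n%:R : R) / n%:R)))%:E))%E.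
Proof.
set u := fun n : nat => _.
have C_gt0 := logsob_gt0 p (1 - p).
have M_ge0 : (0 <= M0 p f)%E.
  by apply: limn_esup_ge0 => k; rewrite lee_fin max_ratio_ge0.
have u_ge0 : (0 <= limn_einf u)%E.
  apply: limn_einf_ge_near; near=> n.
  have n0 : (0 < n)%N by near: n; exact: nbhs_infty_gt.
  rewrite lee_fin divr_ge0 ?max_L1_ge0// mulr_ge0 ?(ltW (hvar _ n0))//.
  by rewrite divr_ge0// ln_ge0// ler1n.
have key (k M : R) : 0 < k -> 0 < M -> logsob p (1 - p) * (k * M) < 1 ->
    (M0 p f < M%:E)%E -> (k%:E <= limn_einf u)%E.
  move=> k0 M_0 CkM fM; apply: limn_einf_ge_near.
  apply: filterS (near_ratio_ge hp hvar hsub k0 M_0 CkM fM) => n.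
  by rewrite /u lee_fin.
move: (logsob p (1 - p)) C_gt0 (C0_le hp hrho) key => C C_gt0 C0_leC key.
have [Meq|Mne] := eqVneq (M0 p f) +oo%E.
  by rewrite Meq invey mule0.
have [Meq|M_gt0] := eqVneq (M0 p f) 0%E.
  (* It suffices that every k > 0 bounds the limit inferior from below; M = 1 / (2 C k) gives C k M
     = 1/2. *)
  apply: (@le_trans _ _ +oo%E); first exact: leey.
  apply: lee_real_lt => // k k0 _.
  apply: (key k (2 * C * k)^-1) => //.
  - by rewrite invr_gt0 !mulr_gt0.
  - rewrite (_ : _ * _ = 2^-1); first by rewrite invf_lt1// ltr1n.
    by field; rewrite !gt_eqF.
  - by rewrite Meq lte_fin invr_gt0 !mulr_gt0.
have [m mE] : exists m : R, M0 p f = m%:E.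
  by case: (M0 p f) M_ge0 Mne => // m _ _; exists m.
have m0 : 0 < m by rewrite -lte_fin lt_def -mE M_gt0.
rewrite mE inver gt_eqF//.
(* C0 <= 1/C reduces the goal to real k below 1 / (C m). *)
apply: (@le_trans _ _ ((C)^-1 * m^-1)%:E).
  by rewrite EFinM lee_wpmul2r ?lee_fin ?invr_ge0 ?(ltW m0)//; exact: C0_leC.
apply: lee_real_lt => // k k0; rewrite lte_fin => km.
have Ckm : C * (k * m) < 1.
  by move: km; rewrite -invfM -[ltRHS]div1r ltr_pdivlMr ?mulr_gt0// mulrCA.
have Ck0 : 0 < C * k by rewrite mulr_gt0.
have mC : m < (C * k)^-1 by rewrite -[ltRHS]div1r ltr_pdivlMr// mulrC -mulrA.
(* The midpoint of m and 1 / (C k) lies above M0 and still satisfies C k M < 1. *)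
apply: (key k ((m + (C * k)^-1) / 2)) => //.
- by rewrite divr_gt0// addr_gt0// invr_gt0.
- rewrite mulrA mulrC -ltr_pdivlMr// div1r; lra.
- rewrite mE lte_fin; lra.
Unshelve. all: by end_near. Qed.
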